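(* Let $\lambda>1$ be a real number. For each integer $n\geq1$, $\mathrm{middle}_{\lambda}(n)>0$ if and only if $\mathrm{blocks}_{\lambda}(n)$ is odd. Furthermore, with $R:=\{n\in\mathbb{Z}_{\geq1}:\mathrm{middle}_{\lambda}(n)>0\}$ and $S:=\{n\in\mathbb{Z}_{\geq1}:\mathrm{blocks}_{\lambda}(n)\text{ odd}\}$, the statement ''$R=S$'' is provable in $\mathbf{KR}_{\lambda}$, i.e. $R,S\in\mathfrak{U}_{\mathbf{KR}_{\lambda}}$ and $\gamma(R)=\gamma(S)$ where $\gamma(n)=\langle\!\langle n\rangle\!\rangle_{\lambda}$.
   Context: For an integer $n\geq1$, $\mathrm{middle}_{\lambda}(n)$ is the number of divisors $d$ of $n$ with $\sqrt{n/\lambda}<d\leq\sqrt{\lambda n}$, and $\mathrm{blocks}_{\lambda}(n)$ is the number of connected components of $\bigcup_{d\mid n}[d,\lambda d]\subseteq\mathbb{R}$. Let $D_n$ be the set of divisors of $n$, $\lambda D_n=\{\lambda d:d\in D_n\}$, and let $u_1<\dots<u_k$ be the elements of the symmetric difference $D_n\triangle\lambda D_n$. Define the word $\langle\!\langle n\rangle\!\rangle_{\lambda}=w_1\cdots w_k\in\{a,b\}^{\ast}$ by $w_i=a$ if $u_i\in D_n\setminus\lambda D_n$ and $w_i=b$ if $u_i\in\lambda D_n\setminus D_n$. The th\'eorie langagi\`ere $\mathbf{KR}_{\lambda}$ is the triple $(\mathbb{Z}_{\geq1},\{a,b\},\gamma)$ with $\gamma(n)=\langle\!\langle n\rangle\!\rangle_{\lambda}$;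 $\mathfrak{U}_{\mathbf{KR}_{\lambda}}$ is the smallest $\sigma$-algebra on $\mathbb{Z}_{\geq1}$ containing all sets $\gamma^{-1}(w)$, $w\in\{a,b\}^{\ast}$. *)

(* Defs.v *)
From HB Require Import structures.
From mathcomp Require Import all_boot all_order all_algebra.
From mathcomp Require Import all_classical all_reals all_analysis.
From mathcomp Require Import finmap.

Set Implicit Arguments.
Unset Strict Implicit.
Unset Printing Implicit Defensive.

Import Order.TTheory GRing.Theory Num.Theory.
Import numFieldNormedType.Exports.

Local Open Scope classical_set_scope.
Local Open Scope ring_scope.

Definition middle (R : realType) (lam : R) (n : nat) : nat :=
  count (fun d : nat =>
           Num.sqrt (n%:R / lam) < d%:R <= Num.sqrt (lam * n%:R)) (divisors n).

Definition divisor_intervals (R : realType) (lam : R) (n : nat) : set R :=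
  \bigcup_(d in [set d : nat | (d %| n)%N]) `[d%:R, lam * d%:R]%classic.

Definition components (T : topologicalType) (A : set T) : set (set T) :=
  [set connected_component A x | x in A].

(* [fset_set] sends an infinite set to [fset0]; lemma
   [finite_components_divisor_intervals] below shows that this default value
   is never used for [n > 0]. *)
Definition blocks (R : realType) (lam : R) (n : nat) : nat :=
  #|` fset_set (components (divisor_intervals lam n))|%fset.

Lemma finite_components_divisor_intervals (R : realType) (lam : R) (n : nat) :
  1 < lam -> (0 < n)%N ->
  finite_set (components (divisor_intervals lam n)).
Proof.
move=> lam1 n0; set U := divisor_intervals lam n.
apply: (@sub_finite_set _ _
  [set connected_component U d%:R | d in [set d : nat | (d < n.+1)%N]]).
  move=> _ [x [d /= dn dx] <-]; exists d => /=.
    by rewrite ltnS dvdn_leq.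
  apply: same_connected_component.
  exists `[d%:R, lam * d%:R]%classic => //; split.
  - rewrite /= in_itv /= lexx /=.
    by rewrite ler_peMl // ltW.
  - by move=> y dy; exists d.
  - exact: segment_connected.
apply: finite_image; exact: finite_II.
Qed.

Inductive letter := letter_a | letter_b.

Definition kr_word (R : realType) (lam : R) (n : nat) : seq letter :=
  let D := [seq d%:R | d <- divisors n] in
  let lamD := [seq lam * x | x <- D] in
  let symdiff := [seq x <- D | x \notin lamD] ++ [seq x <- lamD | x \notin D] in
  [seq if u \in D then letter_a else letter_b | u <- sort <=%R symdiff].

Record langTheory := LangTheory {
  lt_carrier : Type;
  lt_alphabet : Type;
  lt_gamma : lt_carrier -> seq lt_alphabet }.

Definition lt_sigma_algebra (T : langTheory) : set (set (lt_carrier T)) :=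
  <<s [set @lt_gamma T @^-1` [set w] | w in [set: seq (lt_alphabet T)]] >>.

Definition lt_provable_eq (T : langTheory) (A B : set (lt_carrier T)) : Prop :=
  [/\ lt_sigma_algebra A, lt_sigma_algebra B
    & @lt_gamma T @` A = @lt_gamma T @` B].

Definition posint := {n : nat | (0 < n)%N}.

Definition KR (R : realType) (lam : R) : langTheory :=
  @LangTheory posint letter (fun n => kr_word lam (val n)).

(* Main.v *)
Require Import Defs.
From mathcomp Require Import all_boot all_order all_algebra.
From mathcomp Require Import all_classical all_reals all_analysis.
From mathcomp Require Import finmap.

Import Order.TTheory GRing.Theory Num.Theory.
Import numFieldNormedType.Exports.

Local Open Scope classical_set_scope.
Local Open Scope ring_scope.

(** Let c = sqrt (lam * n).  The inversion x |-> c ^ 2 / x = lam * n / x maps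
    [d, lam d] onto [n/d, lam n/d], so it reverses the order of the connected
    components of the union; at most one component is its own mirror image,
    namely the one containing c.  Hence the number of blocks is odd iff c is
    covered, i.e. iff sqrt (n/lam) <= d <= sqrt (lam n) for some d | n; when
    the left inequality is an equality, the divisor n/d = sqrt (lam n) is a
    middle divisor.

    The inversion also swaps D_n with lam D_n, so the first half of the word
    of n consists of the letters located below c.  The excess of a's over b's
    in that half is therefore #{d <= c} - #{d : lam d <= c}, which is
    middle(n): membership in R depends on the word only, and there are
    countably many words. *)

(** * Counting in lists *)

(** Lets a cut by length be read as a cut by position, so that half of a word becomes the letters
    located at or below [c]. *)
Lemma take_count_le_sorted {disp : Order.disp_t} {T : orderType disp}
    (c : T) (s : seq T) :
  sorted <=%O s ->
  take (count (fun x => (x <= c)%O) s) s = [seq x <- s | (x <= c)%O].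
Proof.
elim: s => //= x s IH xs.
case: (leP x c) => [_|cx]; first by rewrite /= IH ?(path_sorted xs).
have /allP min_x := order_path_min le_trans xs.
have s0 : [seq y <- s | (y <= c)%O] = [::].
  rewrite -(filter_pred0 s); apply: eq_in_filter => y /min_x xy.
  by apply/negbTE; rewrite -ltNge (lt_le_trans cx).
by rewrite -size_filter s0.
Qed.

Lemma count_split (T : Type) (a b : pred T) (s : seq T) :
  count a s = (count (predI a b) s + count (predI a (predC b)) s)%N.
Proof.
elim: s => //= x s ->; case: (a x) => //=; case: (b x) => //=.
by rewrite addnCA.
Qed.

(** * Inversion and connected components *)

Definition inversion {R : realType} (c x : R) : R := c ^+ 2 / x.

Section Inversion.
Context {R : realType} {c : R} (c_gt0 : 0 < c).

Lemma inversionK (x : R) : 0 < x -> inversion c (inversion c x) = x.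
Proof.
move=> x0; rewrite /inversion invf_div mulrCA mulfV ?mulr1 //.
by rewrite gt_eqF ?exprn_gt0.
Qed.

Lemma inversion_fix : inversion c c = c.
Proof. by rewrite /inversion expr2 mulfK ?gt_eqF. Qed.

Lemma inversion_le (x : R) : 0 < x -> (inversion c x <= c) = (c <= x).
Proof. by move=> x0; rewrite ler_pdivrMr // expr2 ler_pM2l. Qed.

Lemma inversion_ge (x : R) : 0 < x -> (c <= inversion c x) = (x <= c).
Proof. by move=> x0; rewrite ler_pdivlMr // expr2 ler_pM2l. Qed.

(** The inversion is continuous away from 0 and preserves [U], so it sends connected subsets of [U]
    to connected subsets of [U]. This gives one inclusion; the other is the same one at the inverted
    point, because the inversion is an involution. *)
Lemma inversion_component (U : set R) (x : R) :
  (forall y, U y -> 0 < y) -> (forall y, U y -> U (inversion c y)) -> U x ->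
  inversion c @` connected_component U x
  = connected_component U (inversion c x).
Proof.
move=> Upos Uinv.
have sub z : U z -> inversion c @` connected_component U z `<=`
    connected_component U (inversion c z).
  move=> Uz _ [y [B [Bz BU Bconn] By] <-].
  exists (inversion c @` B); last by exists y.
  split; first by exists z.
    by move=> _ [t Bt <-]; exact/Uinv/BU.
  apply: connected_continuous_connected => //.
  apply: continuous_in_subspaceT => t /set_mem Bt.
  apply: cvgM; first exact: cvg_cst.
  by apply: inv_continuous; rewrite gt_eqF ?(Upos _ (BU _ Bt)).
move=> Ux; apply/seteqP; split; first exact: sub.
move=> y yC; have Uy := connected_component_sub yC.
exists (inversion c y); last by rewrite inversionK ?Upos.
rewrite -{1}[x]inversionK ?Upos //.
by apply: (sub _ (Uinv _ Ux)); exists y.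
Qed.

Lemma odd_components_inversion (U : set R) :
  (forall y, U y -> 0 < y) -> (forall y, U y -> U (inversion c y)) ->
  finite_set (components U) ->
  odd #|` fset_set (components U)|%fset = `[< U c >].
Proof.
move=> Upos Uinv Ufin; set F := fset_set _.
pose g (C : set R) := inversion c @` C.
have memF C : C \in F -> exists2 x, U x & connected_component U x = C.
  by rewrite in_fset_set // => /set_mem.
have Fmem x : U x -> connected_component U x \in F.
  by move=> Ux; rewrite in_fset_set //; apply/mem_set; exists x.
have gF C : C \in F -> g C \in F.
  move=> /memF[x Ux <-]; rewrite /g inversion_component //.
  exact/Fmem/Uinv.
have Fpos C x : C \in F -> C x -> 0 < x.
  by move=> /memF[y Uy <-] /connected_component_sub /Upos.
have gK C : C \in F -> g (g C) = C.
  move=> CF; rewrite /g; apply/seteqP; split.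
    by move=> _ [_ [x Cx <-] <-]; rewrite inversionK ?(Fpos C).
  move=> x Cx; exists (inversion c x); first by exists x.
  by rewrite inversionK ?(Fpos C).
(* [g] is an involution of [F], so any count over [F] may be reindexed along it. *)
have gperm : perm_eq [seq g C | C <- F] F.
  apply: uniq_perm; rewrite ?fset_uniq //.
    rewrite map_inj_in_uniq ?fset_uniq // => C C' CF C'F CC'.
    by rewrite -(gK C) // CC' gK.
  move=> C; apply/mapP/idP => [[C' C'F ->]|CF]; first exact: gF.
  by exists (g C); rewrite ?gK ?gF.
pose lo (C : set R) := `[< forall x, C x -> x < c >].
pose hi (C : set R) := `[< forall x, C x -> c < x >].
pose mid (C : set R) := `[< C c >].
have lohi : count lo F = count hi F.
  rewrite -(permP gperm) count_map; apply: eq_in_count => C CF /=.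
  apply/asboolP/asboolP => gC x Cx.
    have := gC (inversion c x) (imageP _ Cx).
    by rewrite !ltNge inversion_ge ?(Fpos C).
  have [y Cy <-] := Cx.
  by rewrite ltNge inversion_ge ?(Fpos C) // -ltNge gC.
(* For [c] outside [U] its component is empty by definition, so an inhabitant forces [U c]. *)
have ccU x : connected_component U c x -> U c.
  by case=> B [Bc BU _] _; exact: BU.
have midE : count mid F = `[< U c >].
  rewrite -(@eq_in_count _ (pred1 (connected_component U c))).
    rewrite count_uniq_mem ?fset_uniq //; congr nat_of_bool.
    apply/idP/asboolP => [/memF[x Ux xc]|/Fmem//].
    by apply: (ccU x); rewrite -xc; exact: connected_component_refl.
  move=> C /memF[x Ux <-] /=; apply/eqP/asboolP => [xc|xc].
    rewrite xc; apply/connected_component_refl/(ccU x); rewrite -xc.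
    exact: connected_component_refl.
  exact: same_connected_component.
have cpl : count (predC mid) F = (count lo F + count hi F)%N.
  rewrite (count_split _ _ lo); congr addn; apply: eq_in_count => C CF /=.
    apply/andP/idP => [[]//|loC]; split=> //.
    by apply/asboolPn => /(asboolW loC); rewrite ltxx.
  apply/andP/asboolP => [[/asboolPn nCc /asboolPn nlo] x Cx|hiC].
    (* A component with points on both sides of [c] contains [c], since connected subsets of the
       line are intervals. *)
    rewrite ltNge; apply/negP => xc; apply: nlo => y Cy.
    rewrite ltNge; apply/negP => cy; apply: nCc.
    have [z _ Cz] := memF _ CF.
    have /connected_intervalP Citv : connected C.
      by rewrite -Cz; exact: component_connected.
    by apply: (Citv x y) => //; rewrite xc.
  split; apply/asboolPn; first by move=> /hiC; rewrite ltxx.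
  (* [C] is inhabited, so it cannot satisfy [lo] vacuously. *)
  have [x Ux Cx] := memF _ CF.
  have {}Cx : C x by rewrite -Cx; exact: connected_component_refl.
  by move=> /(_ _ Cx); rewrite ltNge ltW ?hiC.
rewrite /= -(count_predC mid F) cpl lohi addnn oddD odd_double addbF midE.
by case: `[< _ >].
Qed.

End Inversion.

(** * Divisor intervals and middle divisors *)

Lemma inversion_divisor (R : realType) (lam : R) (n d : nat) :
  0 < lam -> (0 < n)%N -> (d %| n)%N ->
  inversion (Num.sqrt (lam * n%:R)) d%:R = lam * (n %/ d)%:R.
Proof.
move=> lam0 n0 dn; have d0 : (0 < d)%N := dvdn_gt0 n0 dn.
rewrite /inversion sqr_sqrtr ?mulr_ge0 ?(ltW lam0) // -mulrA; congr (_ * _).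
by rewrite -{1}(divnK dn) natrM mulfK // pnatr_eq0 -lt0n.
Qed.

Lemma sqrt_mul_div (R : realType) (lam x : R) :
  0 < lam -> Num.sqrt (lam * x) = lam * Num.sqrt (x / lam).
Proof.
move=> lam0.
have -> : lam * x = lam ^+ 2 * (x / lam).
  by rewrite [x / lam]mulrC expr2 -mulrA mulVKf ?gt_eqF.
by rewrite sqrtrM ?sqr_ge0 // sqrtr_sqr gtr0_norm.
Qed.

(** Turns both bounds on a middle divisor into comparisons with the single point
    [sqrt (lam * n)]. *)
Lemma middle_range (R : realType) (lam : R) (n d : nat) : 0 < lam ->
  (Num.sqrt (n%:R / lam) < d%:R)
  = (Num.sqrt (lam * n%:R) < lam * d%:R).
Proof. by move=> lam0; rewrite sqrt_mul_div // ltr_pM2l. Qed.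

Lemma inversion_mull (R : realType) (c lam d : R) :
  inversion c (lam * d) = inversion c d / lam.
Proof. by rewrite /inversion invfM mulrCA mulrC. Qed.

Lemma divisor_intervals_gt0 (R : realType) (lam x : R) (n : nat) :
  (0 < n)%N -> divisor_intervals lam n x -> 0 < x.
Proof.
move=> n0 [d /= dn]; rewrite in_itv /= => /andP[dx _].
by rewrite (lt_le_trans _ dx) // ltr0n (dvdn_gt0 n0).
Qed.

Lemma divisor_intervals_inversion (R : realType) (lam x : R) (n : nat) :
  0 < lam -> (0 < n)%N -> divisor_intervals lam n x ->
  divisor_intervals lam n (inversion (Num.sqrt (lam * n%:R)) x).
Proof.
move=> lam0 n0 Ux; have x0 := divisor_intervals_gt0 _ _ _ _ n0 Ux.
case: Ux => d /= dn; rewrite in_itv /= => /andP[dx xd].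
have d0 : 0 < d%:R :> R by rewrite ltr0n (dvdn_gt0 n0).
exists (n %/ d)%N; rewrite /= ?dvdn_div // in_itv /=.
have c0 : 0 < Num.sqrt (lam * n%:R) ^+ 2.
  by rewrite exprn_gt0 // sqrtr_gt0 mulr_gt0 ?ltr0n.
rewrite -inversion_divisor // /inversion ler_pM2l // lef_pV2 ?posrE // dx andbT.
rewrite -(ler_pM2l lam0) -inversion_divisor // /inversion mulrCA ler_pM2l //.
by rewrite ler_pdivlMr // mulrC ler_pdivrMr.
Qed.

Lemma middle_gt0 (R : realType) (lam : R) (n : nat) : 1 < lam -> (0 < n)%N ->
  (0 < middle lam n)%N <->
  divisor_intervals lam n (Num.sqrt (lam * n%:R)).
Proof.
move=> lam1 n0; have lam0 : 0 < lam := lt_trans ltr01 lam1.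
rewrite -has_count; split.
  move=> /hasP[d]; rewrite -dvdn_divisors // middle_range // => dn /andP[cd dc].
  by exists d => //=; rewrite in_itv /= dc ltW.
case=> d /= dn; rewrite in_itv /= => /andP[dc]; rewrite le_eqVlt.
move=> /predU1P[cd|cd]; apply/hasP; last first.
  by exists d; rewrite -?dvdn_divisors // middle_range // cd.
set c := Num.sqrt _ in dc cd *.
have c0 : 0 < c by rewrite sqrtr_gt0 mulr_gt0 ?ltr0n.
have ndc : (n %/ d)%:R = c.
  apply: (mulfI (lt0r_neq0 lam0)).
  rewrite -inversion_divisor // -/c /inversion expr2 -mulrA {2}cd mulfK //.
    by rewrite mulrC.
  by rewrite pnatr_eq0 -lt0n (dvdn_gt0 n0).
exists (n %/ d)%N; first by rewrite -dvdn_divisors // dvdn_div.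
(* The strict lower bound now reads [c < lam * c], which is [1 < lam]. *)
by rewrite middle_range // ndc -/c lexx andbT ltr_pMl.
Qed.

Lemma middle_gt0_odd_blocks (R : realType) (lam : R) (n : nat) :
  1 < lam -> (0 < n)%N -> (0 < middle lam n)%N <-> odd (blocks lam n).
Proof.
move=> lam1 n0; have lam0 : 0 < lam := lt_trans ltr01 lam1.
rewrite /blocks (@odd_components_inversion _ (Num.sqrt (lam * n%:R))).
- by rewrite middle_gt0 //; exact: (rwP (asboolP _)).
- by rewrite sqrtr_gt0 mulr_gt0 ?ltr0n.
- by move=> y; exact: divisor_intervals_gt0.
- by move=> y; exact: divisor_intervals_inversion.
- exact: finite_components_divisor_intervals.
Qed.

(** * The first half of the word *)

Definition is_a (l : letter) : bool := if l is letter_a then true else false.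

(** Truncated subtraction loses nothing on the words [kr_word lam n] with [1 < lam] and [0 < n]:
    there the a's in the first half are at least as many as the b's. *)
Definition midword_height (w : seq letter) : nat :=
  let h := take (size w)./2 w in (count is_a h - count (predC is_a) h)%N.

Lemma middle_midword_height (R : realType) (lam : R) (n : nat) :
  1 < lam -> (0 < n)%N -> middle lam n = midword_height (kr_word lam n).
Proof.
move=> lam1 n0; have lam0 : 0 < lam := lt_trans ltr01 lam1.
rewrite /midword_height /kr_word.
set D := [seq d%:R | d <- divisors n]; set L := [seq lam * x | x <- D].
set A := [seq x <- D | x \notin L]; set B := [seq x <- L | x \notin D].
set c : R := Num.sqrt (lam * n%:R); pose below (x : R) := x <= c.
have c0 : 0 < c by rewrite sqrtr_gt0 mulr_gt0 ?ltr0n.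
have lam_inj : injective ( *%R lam) := mulfI (lt0r_neq0 lam0).
have uD : uniq D.
  rewrite map_inj_uniq ?divisors_uniq // => i j /eqP.
  by rewrite eqr_nat => /eqP.
have uL : uniq L by rewrite map_inj_uniq.
have Dpos x : x \in D -> 0 < x.
  move=> /mapP[d]; rewrite -dvdn_divisors // => /(dvdn_gt0 n0) d0 ->.
  by rewrite ltr0n.
have Lpos x : x \in L -> 0 < x.
  by move=> /mapP[y /Dpos y0 ->]; rewrite mulr_gt0.
have invD x : x \in D -> inversion c x \in L.
  move=> /mapP[d]; rewrite -dvdn_divisors // => dn ->.
  by rewrite inversion_divisor // !map_f // -dvdn_divisors // dvdn_div.
have invL x : x \in L -> inversion c x \in D.
  move=> /mapP[y yD ->]; rewrite inversion_mull.
  by have /mapP[z zD ->] := invD _ yD; rewrite mulrC mulKf ?gt_eqF.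
have permAB : perm_eq [seq inversion c x | x <- A] B.
  apply: uniq_perm; rewrite ?filter_uniq // ?map_inj_in_uniq ?filter_uniq //.
    move=> x y; rewrite !mem_filter => /andP[_ /Dpos x0] /andP[_ /Dpos y0] xy.
    by rewrite -(inversionK c0 _ x0) xy inversionK.
  move=> y; rewrite mem_filter; apply/mapP/andP => [[x]|[yD yL]].
    rewrite mem_filter => /andP[xL xD] ->; split; last exact: invD.
    by apply: contra xL => /invD; rewrite (inversionK c0) ?Dpos.
  exists (inversion c y); last by rewrite (inversionK c0) ?Lpos.
  rewrite mem_filter invL // andbT; apply: contra yD => /invL.
  by rewrite (inversionK c0) ?Lpos.
have belowB : count below B = count (predC below) A.
  rewrite -(permP permAB) count_map; apply: eq_in_count => x /=.
  rewrite mem_filter /below => /andP[xL xD].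
  (* Here [c <= x] is strict: [c] is fixed by the inversion, so [x = c] would lie in [L] as well. *)
  rewrite (inversion_le c0) ?Dpos // -ltNge le_eqVlt orb_idl // => /eqP cx.
  by move: xL; rewrite -cx -{1}(inversion_fix c0) invD ?cx.
have half : (size (A ++ B))./2 = count below (A ++ B).
  rewrite size_cat -(perm_size permAB) size_map addnn doubleK.
  by rewrite count_cat belowB count_predC.
rewrite size_map size_sort half -map_take -(permP (permEl (perm_sort <=%R _))).
rewrite take_count_le_sorted ?sort_le_sorted // !count_map !count_filter.
rewrite !(permP (permEl (perm_sort <=%R _))) !count_cat.
set a1 := count _ A; set a2 := count _ B.
set b1 := count _ A; set b2 := count _ B.
have -> : a1 = count below A.
  apply: eq_in_count => x; rewrite mem_filter => /andP[_ xD] /=.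
  by rewrite xD.
have -> : a2 = 0%N.
  rewrite -(count_pred0 B).
  apply: eq_in_count => x; rewrite mem_filter => /andP[xD _] /=.
  by rewrite (negbTE xD).
have -> : b1 = 0%N.
  rewrite -(count_pred0 A).
  apply: eq_in_count => x; rewrite mem_filter => /andP[_ xD] /=.
  by rewrite xD.
have -> : b2 = count below B.
  apply: eq_in_count => x; rewrite mem_filter => /andP[xD _] /=.
  by rewrite (negbTE xD).
rewrite addn0 add0n.
(* Elements shared by [D] and [L] leave no letter; they add equally to both counts and can be
   restored. *)
have common : count (predI below (mem L)) D = count (predI below (mem D)) L.
  rewrite -[LHS]size_filter -[RHS]size_filter.
  apply/perm_size/uniq_perm; rewrite ?filter_uniq // => x.
  by rewrite !mem_filter /= -!andbA [_ && (x \in D)]andbC.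
have cD : count below D = (count (predI below (mem L)) D + count below A)%N.
  by rewrite (count_split _ _ (mem L)) count_filter.
have cL : count below L = (count (predI below (mem D)) L + count below B)%N.
  by rewrite (count_split _ _ (mem D)) count_filter.
suff mD : count below D = (middle lam n + count below L)%N.
  by rewrite -(subnDl (count (predI below (mem D)) L)) -cL -common -cD mD addnK.
(* Split the divisors [d <= c] by whether [lam * d <= c]: those failing it are the middle ones, and
   those satisfying it have [d <= c] automatically. *)
rewrite /L !count_map (count_split _ _ (fun d => below (lam * d%:R))) addnC.
congr addn; apply: eq_count => d /=; rewrite /below.
  by rewrite middle_range // -/c -ltNge andbC.
apply: andb_idl; apply: le_trans.
by rewrite ler_peMl // ltW.
Qed.

(** * Measurability of sets determined by the word *)

Lemma letter_word_countable : exists f : nat -> seq letter,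
  forall w, exists i, f i = w.
Proof.
pose dec (b : bool) := if b then letter_a else letter_b.
(* The default [[::]] for codes of no word is harmless, as only surjectivity is wanted. *)
pose words i := odflt [::] (choice.unpickle i : option (seq bool)).
exists (fun i => [seq dec b | b <- words i]) => w.
exists (choice.pickle [seq is_a l | l <- w]).
rewrite /words choice.pickleK /= -map_comp -[RHS]map_id.
by apply: eq_map => -[].
Qed.

Lemma sigma_algebra_word_preimage (T : Type) (g : T -> seq letter)
    (W : set (seq letter)) :
  @lt_sigma_algebra (LangTheory g) (g @^-1` W).
Proof.
have [f fsurj] := letter_word_countable; rewrite /lt_sigma_algebra /=.
(* The union runs over an enumeration of all words, those outside [W] contributing the empty set. *)
have -> : g @^-1` W =
    \bigcup_i (if `[< W (f i) >] then g @^-1` [set f i] else set0).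
  apply/seteqP; split => [x Wx|x [i _]].
    have [i fi] := fsurj (g x); exists i => //.
    by rewrite fi; case: asboolP.
  by case: asboolP => //= Wf ->.
apply: sigma_algebra_bigcup => i; case: ifP => _; last exact: sigma_algebra0.
by apply: sub_sigma_algebra; exists (f i).
Qed.

Theorem theorem12 (R : realType) (lam : R) (hlam : 1 < lam) :
  (forall n : nat, (0 < n)%N -> ((0 < middle lam n)%N <-> odd (blocks lam n)))
  /\ @lt_provable_eq (KR lam)
       [set n : posint | (0 < middle lam (val n))%N]
       [set n : posint | odd (blocks lam (val n))].
Proof.
split=> [n n0|]; first exact: middle_gt0_odd_blocks.
have RS : [set n : posint | (0 < middle lam (val n))%N]
    = [set n : posint | odd (blocks lam (val n))].
  by apply/seteqP; split=> n /=; rewrite middle_gt0_odd_blocks ?(valP n).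
have sR : @lt_sigma_algebra (KR lam)
    [set n : posint | (0 < middle lam (val n))%N].
  rewrite [X in @lt_sigma_algebra _ X](_ : _ =
    (fun n : posint => kr_word lam (val n)) @^-1`
      [set w | (0 < midword_height w)%N]).
    exact: sigma_algebra_word_preimage.
  by apply/seteqP; split=> n /=; rewrite middle_midword_height ?(valP n).
(* As [R = S] as sets, measurability of [S] and equality of the images are immediate. *)
by split; rewrite -?RS.
Qed.
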